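(* Let $Q$ be a finitely generated nilpotent group and $\prec$ a full archimedean order on $Q$. Then there exist a normal subgroup $P\trianglelefteq Q$ and an injective group homomorphism $\iota\colon Z(Q/P)\hookrightarrow(\mathbb{R},+)$ on the center $Z(Q/P)$ of $Q/P$ such that for all $g\in Q$ $$1\prec g \quad\text{if and only if}\quad gP \text{ is central in } Q/P \text{ and } \iota(gP)>0.$$
   Context: An order on a group $G$ means a bi-invariant strict partial order: a relation $\prec$ on $G$ such that for all $f,g,h\in G$: not $g\prec g$; $g\prec h$ implies not $h\prec g$; $f\prec g$ and $g\prec h$ imply $f\prec h$; and $f\prec g$ implies $hf\prec hg$ and $fh\prec gh$. An element $g$ is positive if $1\prec g$. A subset $S\subseteq G$ is an antichain if $s\prec t$ holds for no $s,t\in S$. If $\Phi\colon G\to Q$ is a group homomorphism and $\prec_Q$ is an order on $Q$, the order on $G$ induced by $\Phi$ (and $\prec_Q$) is given by $g\prec h \iff \Phi(g)\prec_Q\Phi(h)$. An order $\prec$ on $G$ is archimedean if there are no $g,h\in G$ with $g$ positive and $g^i\prec h$ for all $i\in\mathbb{Z}$. It is primitive if for all $g,h\in G$ and $n\in\mathbb{N}$, $g^n\prec h^n$ implies $g\prec h$. It is factorizing if for every normal subgroup $H\trianglelefteq G$ that is an antichain, $\prec$ is induced by the projection $G\to G/H$ for some order on $G/H$. It is full if it is primitive and factorizing. *)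

(* Defs.v *)
From HB Require Import structures.
From mathcomp Require Import all_boot all_order all_algebra generic_quotient.
From mathcomp Require Import boolp classical_sets reals.

Set Implicit Arguments.
Unset Strict Implicit.
Unset Printing Implicit Defensive.

Local Open Scope classical_set_scope.
Local Open Scope group_scope.

Section Subgroups.
Variable G : groupType.

Definition is_subgroup (A : set G) : Prop :=
  [/\ A 1,
      forall x y, A x -> A y -> A (x * y)
    & forall x, A x -> A x^-1].

Record normalSubgroup := NormalSubgroup {
  nsg_set :> set G;
  nsg_subgroup : is_subgroup nsg_set;
  nsg_conj : forall x g, nsg_set x -> nsg_set (x ^ g) }.

Definition generated (A : set G) : set G := smallest is_subgroup A.

Definition finitely_generated : Prop :=
  exists s : seq G, generated [set` s] = setT.

(* Indexed from 0: term n is usually written gamma_(n+1)(G). *)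
Fixpoint lower_central (n : nat) : set G :=
  if n is m.+1 then
    generated [set c | exists x y, lower_central m x /\ c = [~ x, y]]
  else setT.

Definition nilpotent_group : Prop :=
  exists n, lower_central n = [set 1].

Definition central (x : G) : Prop := forall y, commute x y.

Definition expgz (x : G) (i : int) : G :=
  match i with Posz n => x ^+ n | Negz n => x ^- n.+1 end.

End Subgroups.

Section Quotient.
Variables (G : groupType) (N : normalSubgroup G).

Definition coset_rel : rel G := fun x y => `[< nsg_set N (x^-1 * y) >].

Lemma coset_rel_refl : reflexive coset_rel.
Proof. by move=> x; apply/asboolP; rewrite mulVg; case: (nsg_subgroup N). Qed.

Lemma coset_rel_sym : symmetric coset_rel.
Proof.
move=> x y; apply/asboolP/asboolP; case: (nsg_subgroup N) => _ _ NV /NV;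
by rewrite invgM invgK.
Qed.

Lemma coset_rel_trans : transitive coset_rel.
Proof.
move=> y x z /asboolP Nxy /asboolP Nyz; apply/asboolP.
case: (nsg_subgroup N) => _ NM _; have := NM _ _ Nxy Nyz.
by rewrite -mulgA mulVKg.
Qed.

Canonical coset_equiv :=
  EquivRel coset_rel coset_rel_refl coset_rel_sym coset_rel_trans.

Definition quotientg := {eq_quot coset_rel}%qT.

HB.instance Definition _ := Choice.on quotientg.
HB.instance Definition _ := EqQuotient.on quotientg.

Definition cosetg (x : G) : quotientg := (\pi_quotientg x)%qT.

Lemma cosetgP (x y : G) : cosetg x = cosetg y <-> nsg_set N (x^-1 * y).
Proof. by split=> [/eqquotP/asboolP|h]; last exact/eqquotP/asboolP. Qed.

Lemma cosetg_repr (a : quotientg) : cosetg (repr a) = a.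
Proof. exact: reprK. Qed.

Lemma cosetg_mulP (x x' y y' : G) : cosetg x = cosetg x' ->
  cosetg y = cosetg y' -> cosetg (x * y) = cosetg (x' * y').
Proof.
move=> /cosetgP Nx /cosetgP Ny; apply/cosetgP.
have [_ NM _] := nsg_subgroup N.
have := NM _ _ (nsg_conj y Nx) Ny.
by rewrite conjgE invgM !mulgA mulgK.
Qed.

Lemma cosetg_invP (x x' : G) : cosetg x = cosetg x' ->
  cosetg x^-1 = cosetg x'^-1.
Proof.
move=> /esym/cosetgP Nx; apply/cosetgP.
have := nsg_conj x'^-1 Nx.
by rewrite conjgE !invgK mulgA mulVKg.
Qed.

Definition quotientg_mul (a b : quotientg) := cosetg (repr a * repr b).
Definition quotientg_one := cosetg 1.
Definition quotientg_inv (a : quotientg) := cosetg (repr a)^-1.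

Lemma quotientg_mulE x y :
  quotientg_mul (cosetg x) (cosetg y) = cosetg (x * y).
Proof. by apply: cosetg_mulP; rewrite cosetg_repr. Qed.

Lemma quotientg_invE x : quotientg_inv (cosetg x) = cosetg x^-1.
Proof. by apply: cosetg_invP; rewrite cosetg_repr. Qed.

Lemma quotientg_mulA : associative quotientg_mul.
Proof.
move=> a b c; rewrite -(cosetg_repr a) -(cosetg_repr b) -(cosetg_repr c).
by rewrite !quotientg_mulE mulgA.
Qed.

Lemma quotientg_mul1 : left_id quotientg_one quotientg_mul.
Proof. by move=> a; rewrite -(cosetg_repr a) quotientg_mulE mul1g. Qed.

Lemma quotientg_mulr1 : right_id quotientg_one quotientg_mul.
Proof. by move=> a; rewrite -(cosetg_repr a) quotientg_mulE mulg1. Qed.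

Lemma quotientg_mulV : left_inverse quotientg_one quotientg_inv quotientg_mul.
Proof.
by move=> a; rewrite -(cosetg_repr a) quotientg_invE quotientg_mulE mulVg.
Qed.

Lemma quotientg_mulrV : right_inverse quotientg_one quotientg_inv quotientg_mul.
Proof.
by move=> a; rewrite -(cosetg_repr a) quotientg_invE quotientg_mulE mulgV.
Qed.

HB.instance Definition _ := isGroup.Build quotientg quotientg_mulA
  quotientg_mul1 quotientg_mulr1 quotientg_mulV quotientg_mulrV.

Lemma cosetg_morphism : monoid_morphism cosetg.
Proof. by split=> // x y; rewrite -quotientg_mulE. Qed.

HB.instance Definition _ :=
  isUMagmaMorphism.Build G quotientg cosetg cosetg_morphism.

End Quotient.

Section Center.
Variable G : groupType.

Definition centerg := {x : G | `[< central x >]}.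

HB.instance Definition _ := SubChoice.on centerg.

Lemma central_group_closed : group_closed [pred x : G | `[< central x >]].
Proof.
split=> [|x y /asboolP cx /asboolP cy]; apply/asboolP => z.
  exact/commute_sym/commute1.
apply/commute_sym/commuteM; first exact/commute_sym/cx.
by apply/commuteV/commute_sym/cy.
Qed.

HB.instance Definition _ :=
  SubChoice_isSubGroup.Build G _ centerg central_group_closed.

Definition to_center (x : G) (cx : central x) : centerg :=
  exist _ x (asboolT cx).

End Center.

Section Orders.
Variable G : groupType.
Implicit Types lt : G -> G -> Prop.

Definition bi_order lt : Prop :=
  [/\ forall g, ~ lt g g,
      forall g h, lt g h -> ~ lt h g,
      forall f g h, lt f g -> lt g h -> lt f h
    & forall f g h, lt f g -> lt (h * f) (h * g) /\ lt (f * h) (g * h)].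

Definition antichain lt (S : set G) : Prop :=
  forall s t, S s -> S t -> ~ lt s t.

Definition induced_order (Q : groupType) (Phi : {multiplicative G -> Q})
    (ltQ : Q -> Q -> Prop) : G -> G -> Prop :=
  fun g h => ltQ (Phi g) (Phi h).

Definition archimedean_order lt : Prop :=
  ~ exists g h, lt 1 g /\ forall i : int, lt (expgz g i) h.

Definition primitive_order lt : Prop :=
  forall g h (n : nat), lt (g ^+ n) (h ^+ n) -> lt g h.

End Orders.

Section FullOrders.
Variable G : groupType.
Implicit Types lt : G -> G -> Prop.

Definition factorizing_order lt : Prop :=
  forall H : normalSubgroup G, antichain lt H ->
  exists2 ltH : quotientg H -> quotientg H -> Prop,
    bi_order ltH
    & forall g h, lt g h <-> induced_order (cosetg H) ltH g h.

Definition full_order lt : Prop :=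
  primitive_order lt /\ factorizing_order lt.

End FullOrders.

(* Main.v *)
Require Import Defs.
From mathcomp Require Import all_boot all_order all_algebra.
From mathcomp Require Import boolp classical_sets reals.
From mathcomp Require Import ring lra zify.

(** Since the order is factorizing, the largest normal antichain of Q is

      P = {x | for all g, 1 < g iff 1 < x g}.

    The order therefore descends to G = Q/P, where the only normal antichain is
    the trivial subgroup; it is still primitive and archimedean, and G is
    nilpotent.

    The center of G is totally ordered: if z <> 1 is central, the cyclic
    subgroup of z is normal, so some power of z is positive, and primitivity
    makes z or z^-1 positive ([central_total]).  Hoelder's theorem ([hoelder])
    embeds the center in the real numbers.  What remains is that positive
    elements of G are central ([pos_central]), which rests on two facts.

    - An element u of G whose powers all lie between two fixed elements a and b
      is trivial ([bounded_powers_eq1]).  The commutators of these powers with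
      a fixed w again lie between two fixed elements, and modulo a lower term of
      the upper central series they are the powers of [u, w]; after finitely
      many steps all powers of a nontrivial central element are bounded, against
      the archimedean property.

    - If g is positive and the conjugates of g by powers of y commute, then
      g [g, y]^k is positive for all k ([pos_mul_comm_exp]).  The conjugates of
      g generate a module over Z[X], where X acts as conjugation by y and X - 1
      is nilpotent.  Nonzero polynomials with nonnegative coefficients send g
      to positive elements.  Moreover (y a)^n = y^n a' for
      a' = (1 + X + ... + X^(n-1)) a, so primitivity says that a is positive as
      soon as a' is.  The inequality follows from an identity in Z[X]: for a
      suitable n, multiplying 1 + k (X - 1) twice by 1 + X + ... + X^(n-1) gives
      nonnegative coefficients up to a multiple of a given power of X - 1
      ([smoothing_certificate]).

    Now let g be positive and let y lie in the n-th term of the upper central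
    series.  By induction on n, positive elements commute with the term below,
    which makes the conjugates of g by y commute.  The second fact, for y and
    for y^-1, bounds all powers of [g, y] from one side, hence from both, and
    the first fact gives [g, y] = 1. *)

Set Implicit Arguments.
Unset Strict Implicit.
Unset Printing Implicit Defensive.
Import Order.TTheory GRing.Theory Num.Theory.

(** * A positivity certificate for integer polynomials *)

Notation nneg_poly := (polyOver (@Num.Def.nneg_num_pred int)).

Section PolynomialCertificate.
Local Open Scope ring_scope.

Definition geom (R : nzRingType) (n : nat) (P : {poly R}) :=
  \sum_(i < n) P ^+ i.

Lemma geom_recl (R : nzRingType) n (P : {poly R}) :
  geom n.+1 P = geom n P * P + 1.
Proof.
rewrite /geom big_ord_recl expr0 addrC mulr_suml; congr (_ + _).
by apply: eq_bigr => i _; rewrite -exprSr.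
Qed.

Lemma geom_recr (R : nzRingType) n (P : {poly R}) :
  geom n.+1 P = geom n P + P ^+ n.
Proof. by rewrite /geom big_ord_recr. Qed.

Lemma geomD (R : nzRingType) m n (P : {poly R}) :
  geom (m + n) P = geom m P + P ^+ m * geom n P.
Proof.
elim: n => [|n IH]; first by rewrite addn0 /geom big_ord0 mulr0 addr0.
by rewrite addnS !geom_recr IH mulrDr addrA exprD.
Qed.

(** Every integer below m n is uniquely i + n j with i < n and j < m. *)
Lemma geomM (R : comNzRingType) m n (P : {poly R}) :
  geom (m * n) P = geom n P * geom m (P ^+ n).
Proof.
elim: m => [|m IH]; first by rewrite /geom !big_ord0 mulr0.
by rewrite mulSnr geomD IH geom_recr mulrDr -exprM (mulnC n) [_ * P ^+ _]mulrC.
Qed.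

Lemma geom_telescope (R : comNzRingType) n (P : {poly R}) :
  (P - 1) * geom n P = P ^+ n - 1.
Proof. by rewrite -subrX1. Qed.

Lemma nneg_geom n (P : {poly int}) :
  P \is a nneg_poly -> geom n P \is a nneg_poly.
Proof. by move=> P0; rewrite /geom; apply: rpred_sum => i _; exact: rpredX. Qed.

(** With P = X^L, N = 1 + ... + X^(n-1) and n = (J+1) L, the subtracted terms
    L X^(l L), 0 < l <= J, sit where the partial sums of the coefficients of N
    already exceed L, and multiplying by N takes partial sums.  Explicitly,

      N (N - L P G) = A G + M^2 P^J + P^(J+1) G (M^2 - A)

    for G = 1 + ... + P^(J-1), M = 1 + ... + X^(L-1) and A the sum over i < L of
    X^i (1 + ... + X^(L-i-1)), which is bounded by M^2 coefficientwise. *)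
Lemma nneg_geom_mul_sub (L J : nat) :
  geom (J.+1 * L) 'X * (geom (J.+1 * L) 'X - L%:R * 'X^L * geom J 'X^L)
    \is a nneg_poly.
Proof.
set P : {poly int} := 'X^L; pose M : {poly int} := geom L 'X.
pose A : {poly int} := \sum_(i < L) 'X^i * geom (L - i) 'X.
have nX : ('X : {poly int}) \is a nneg_poly by exact: polyOverX.
have nP : P \is a nneg_poly by apply: rpredX.
have nN n : geom n ('X : {poly int}) \is a nneg_poly by exact: nneg_geom.
have eqN : geom (J.+1 * L) 'X = M * geom J.+1 P by rewrite geomM.
have eqB : M ^+ 2 - A = \sum_(i < L) 'X^i * (M - geom (L - i) 'X).
  under [RHS]eq_bigr => i _ do rewrite mulrBr.
  by rewrite sumrB -mulr_suml -/M.
have nA : A \is a nneg_poly.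
  by apply: rpred_sum => i _; apply: rpredM; rewrite ?rpredX.
have nB : M ^+ 2 - A \is a nneg_poly.
  rewrite eqB; apply: rpred_sum => i _; apply: rpredM; first exact: rpredX.
  have -> : M = geom (L - i) 'X + 'X^(L - i) * geom i 'X.
    by rewrite -geomD subnK // ltnW.
  by rewrite addrC addKr rpredM ?rpredX.
have eqA : geom (J.+1 * L) 'X * (M - L%:R * P) = A * (1 - P ^+ J.+1).
  have -> : M - L%:R * P = \sum_(i < L) 'X^i * (1 - 'X^(L - i)).
    under eq_bigr => i _ do
      rewrite mulrBr mulr1 -exprD (subnKC (ltnW (ltn_ord i))).
    by rewrite sumrB sumr_const card_ord mulr_natl.
  rewrite mulr_sumr mulr_suml; apply: eq_bigr => i _.
  have e1 : 'X^(L - i) = 1 + ('X - 1) * geom (L - i) 'X :> {poly int}.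
    by rewrite geom_telescope addrC subrK.
  have e2 : P ^+ J.+1 = 1 + ('X - 1) * geom (J.+1 * L) 'X.
    by rewrite geom_telescope mulnC exprM addrC subrK.
  by rewrite e1 e2; ring.
have -> : geom (J.+1 * L) 'X * (geom (J.+1 * L) 'X - L%:R * P * geom J P) =
  A * geom J P + M ^+ 2 * P ^+ J + P ^+ J.+1 * geom J P * (M ^+ 2 - A).
  have -> : geom (J.+1 * L) 'X * (geom (J.+1 * L) 'X - L%:R * P * geom J P) =
    geom (J.+1 * L) 'X * (M - L%:R * P) * geom J P
    + M * geom J.+1 P * M * P ^+ J.
    by rewrite eqN geom_recr; ring.
  by rewrite eqA geom_recl [P ^+ J.+1]exprS; ring.
apply: rpredD; last first.
  by apply: rpredM nB; apply: rpredM; rewrite ?rpredX ?nneg_geom.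
apply: rpredD; first by rewrite rpredM ?nneg_geom.
by apply: rpredM; rewrite rpredX ?nN.
Qed.

(** The coefficients of 1 - (1 - P)^J on P, ..., P^J are binomial coefficients
    up to sign, hence at most 2^J in absolute value, whatever P is. *)
Lemma nneg_sub_binomial (k J : nat) (P : {poly int}) :
  P \is a nneg_poly ->
  (k * 2 ^ J)%:R * P * geom J P - k%:R * (1 - (1 - P) ^+ J)
    \is a nneg_poly.
Proof.
move=> nP.
have -> : (k * 2 ^ J)%:R * P * geom J P - k%:R * (1 - (1 - P) ^+ J) =
   \sum_(l < J) ((k * 2 ^ J)%:R + k%:R * ((-1) ^+ l.+1 *+ 'C(J, l.+1)))
      * P ^+ l.+1.
  rewrite exprBn big_ord_recl expr0 bin0 !expr1n !mul1r mulr1n.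
  rewrite opprD addrA subrr sub0r mulrN opprK -mulrA /geom !mulr_sumr.
  rewrite -big_split; apply: eq_bigr => l _ /=.
  rewrite mulrDl; congr (_ + _); first by rewrite exprS.
  by rewrite /bump add1n expr1n mulr1 -mulrnAl mulrA.
apply: rpred_sum => l _; apply: rpredM; last exact: rpredX.
rewrite natrM -mulrDr; apply: rpredM; first exact: rpred_nat.
have lJ : ('C(J, l.+1) <= 2 ^ J)%N.
  rewrite -[2%N]/(1 + 1)%N expnDn; under eq_bigr do rewrite !exp1n !muln1.
  by rewrite (bigD1 (lift ord0 l)) //= /bump add1n leq_addr.
rewrite -(subnK lJ) natrD -addrA -signr_odd.
apply: rpredD; first exact: rpred_nat.
case: odd; first by rewrite expr1 mulNrn addrN rpred0.
by rewrite expr0 rpredD // rpred_nat.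
Qed.

(** For N = 1 + ... + X^(n-1) one has

      N^2 (1 + k (X - 1)) = N (N - k) + k X^n N,

    and only the constant k spoils nonnegativity.  Modulo (X - 1)^(J+1) it may
    be replaced by k (1 - (1 - X^L)^(J+1)), a combination of the powers
    X^L, ..., X^((J+1) L) with coefficients bounded independently of L; for L
    large, N times this combination has smaller coefficients than N^2. *)
Lemma smoothing_certificate (k J : nat) :
  exists (n : nat) (q s : {poly int}),
    [/\ q \is a nneg_poly, 0 < q.[1]
      & geom n 'X * (geom n 'X * (1 + k%:R * ('X - 1)))
        = q + ('X - 1) ^+ J.+1 * s].
Proof.
(* k + 1 instead of k keeps L, hence n, positive when k = 0; the term N of q
   makes up for it. *)
pose L := (k.+1 * 2 ^ J.+1)%N; pose n := (J.+2 * L)%N.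
pose P : {poly int} := 'X^L; pose N : {poly int} := geom n 'X.
have nX : ('X : {poly int}) \is a nneg_poly by exact: polyOverX.
pose q : {poly int} :=
  N * (N - k.+1%:R * (1 - (1 - P) ^+ J.+1)) + N + k%:R * 'X^n * N.
pose s : {poly int} := - (k.+1)%:R * N * (- geom L 'X) ^+ J.+1.
exists n, q, s.
have eqP : (1 - P) ^+ J.+1 = ('X - 1) ^+ J.+1 * (- geom L 'X) ^+ J.+1.
  by rewrite -exprMn mulrN geom_telescope opprB.
have E : N * (N * (1 + k%:R * ('X - 1))) = q + ('X - 1) ^+ J.+1 * s.
  have -> : N * (N * (1 + k%:R * ('X - 1))) =
     N * (N + k%:R * (('X - 1) * N)) by ring.
  have -> : ('X - 1) ^+ J.+1 * s =
     - k.+1%:R * N * (('X - 1) ^+ J.+1 * (- geom L 'X) ^+ J.+1).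
    by rewrite /s mulrCA.
  by rewrite -eqP geom_telescope /q; ring.
split=> //.
- have nN : N \is a nneg_poly by exact: nneg_geom.
  rewrite /q; apply: rpredD; last by rewrite !rpredM ?rpred_nat ?rpredX.
  apply: rpredD => //.
  have nP : P \is a nneg_poly by apply: rpredX.
  have -> : N * (N - k.+1%:R * (1 - (1 - P) ^+ J.+1)) =
     N * (N - L%:R * P * geom J.+1 P)
     + N * (L%:R * P * geom J.+1 P - k.+1%:R * (1 - (1 - P) ^+ J.+1)) by ring.
  rewrite rpredD //; first exact: nneg_geom_mul_sub.
  by rewrite rpredM // nneg_sub_binomial.
have X1 : ('X - 1 : {poly int}).[1] = 0 by rewrite !hornerE subrr.
have root1 (t : {poly int}) : (('X - 1) ^+ J.+1 * t).[1] = 0.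
  by rewrite hornerM horner_exp X1 expr0n mul0r.
have -> : q.[1] = (N * (N * (1 + k%:R * ('X - 1)))).[1].
  by rewrite E hornerD root1 addr0.
rewrite !hornerE /= ?subrr ?mulr0 ?addr0 ?mulr1.
have -> : N.[1] = n%:R.
  rewrite /N /geom horner_sum; under eq_bigr do rewrite hornerXn expr1n.
  by rewrite sumr_const card_ord.
by rewrite mulr_gt0 // ltr0n /n /L !muln_gt0 expn_gt0.
Qed.
End PolynomialCertificate.

Local Open Scope group_scope.

(** * Integer powers, commutators and the upper central series *)

Section IntegerPowers.
Variable G : groupType.
Implicit Types (x y : G) (i j : int).

Lemma expgzN x i : expgz x (- i)%R = (expgz x i)^-1.
Proof.
case: i => [[|n]|n]; first by rewrite oppr0 /= expg0 invg1.
  by rewrite -NegzE.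
by rewrite NegzE opprK /= invgK.
Qed.

Lemma expgzS x i : expgz x (i + 1)%R = expgz x i * x.
Proof.
case: i => [n|[|n]]; first by rewrite -PoszD addn1 /= expgSr.
  by rewrite /= expg1 mulVg.
have -> : (Negz n.+1 + 1 = Negz n)%R by rewrite !NegzE -addn1 PoszD opprD subrK.
by rewrite /= [x ^+ n.+2]expgS invgM mulgVK.
Qed.

Lemma expgzD x i j : expgz x (i + j)%R = expgz x i * expgz x j.
Proof.
elim: j => [|n IH|n IH]; first by rewrite addr0 mulg1.
  by rewrite -addn1 PoszD addrA !expgzS IH mulgA.
apply: (mulIg x); rewrite -mulgA -!expgzS -addn1 PoszD opprD addrA !subrK.
exact: IH.
Qed.

Lemma commuteXz x y i : commute x y -> commute x (expgz y i).
Proof.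
by case: i => n cxy /=; [apply: commuteX | apply/commuteV/commuteX].
Qed.

Lemma expgzMl x y i : commute x y -> expgz (x * y) i = expgz x i * expgz y i.
Proof.
move=> cxy; case: i => n /=; rewrite expgMn //; rewrite invgM.
exact/commute_sym/commuteV/commute_sym/commuteV/commuteX2.
Qed.

Lemma expgzM x i (n : nat) : expgz x (i * n%:Z)%R = expgz x i ^+ n.
Proof.
elim: n => [|n IH]; first by rewrite mulr0 expg0.
by rewrite intS mulrDr mulr1 expgzD IH expgS.
Qed.

Lemma gmulfXz (H : groupType) (f : UMagmaMorphism.type G H) x i :
  f (expgz x i) = expgz (f x) i.
Proof. by case: i => n /=; rewrite ?gmulfV gmulfXn. Qed.

End IntegerPowers.

Section Commutators.
Variable G : groupType.
Implicit Types x y z e u w : G.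

Lemma conjg_central e w : central e -> e ^ w = e.
Proof. by move=> ce; apply/conjg_fixP/commgP/ce. Qed.

Lemma commMr_central x e w : central e -> [~ x * e, w] = [~ x, w].
Proof.
move=> ce; rewrite !commgEl conjMg (conjg_central _ ce) invgM.
by rewrite -mulgA [x^-1 * _]mulgA -ce mulKg.
Qed.

Lemma commXz_central u w i : central [~ u, w] ->
  [~ expgz u i, w] = expgz [~ u, w] i.
Proof.
move=> cc; have -> : [~ expgz u i, w] = (expgz u i)^-1 * expgz (u ^ w) i.
  by rewrite commgEl; case: i => n /=; rewrite ?conjVg conjXg.
have -> : u ^ w = u * [~ u, w] by rewrite commgEl mulVKg.
by rewrite expgzMl ?mulKg //; apply/commute_sym/cc.
Qed.

Lemma commMgJ x y z : [~ x * y, z] = [~ x, z] ^ y * [~ y, z].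
Proof. by rewrite !commgEl !conjgE !invgM !mulgA !mulgK. Qed.

End Commutators.

Section UpperCentralSeries.
Variable G : groupType.

(** The n-th term Z_n of the upper central series, as a predicate: x lies in Z_n
    iff all its n-fold commutators [x, y_1, ..., y_n] are trivial. *)
Fixpoint upper_central (n : nat) (x : G) : Prop :=
  if n is m.+1 then forall y, upper_central m [~ x, y] else x = 1.

Lemma upper_central_conj n x g : upper_central n x -> upper_central n (x ^ g).
Proof.
elim: n x => [|n IH] x /= => [->|ux y]; first exact: conj1g.
by rewrite -[y](conjgKV g) -conjRg; apply/IH/ux.
Qed.

Lemma upper_central_subgroup n : is_subgroup (upper_central n).
Proof.
elim: n => [|n [u1 uM uV]] /=.
  by split=> // [x y -> ->|x ->]; rewrite ?mulg1 ?invg1.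
split=> [y|x y ux uy z|x ux y]; first by rewrite comm1g.
  by rewrite commMgJ; apply: uM => //; apply: upper_central_conj.
have -> : [~ x^-1, y] = ([~ x, y] ^ x^-1)^-1.
  by rewrite /commg /conjg !gnorm.
exact/uV/upper_central_conj/ux.
Qed.

Definition upper_central_nsg n : normalSubgroup G :=
  NormalSubgroup (upper_central_subgroup n)
    (fun x g ux => upper_central_conj g ux).

Lemma central_coset n x :
  upper_central n.+1 x -> central (cosetg (upper_central_nsg n) x).
Proof.
move=> ux b; rewrite -(cosetg_repr b); apply/commgP/eqP.
rewrite -gmulfR; transitivity (cosetg (upper_central_nsg n) 1);
  last exact: gmulf1.
by apply/esym/cosetgP; rewrite invg1 mul1g; apply: ux.
Qed.

Lemma lower_central_upper n (c : nat) x : (n <= c)%N ->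
  @lower_central G c = [set 1]%classic -> @lower_central G n x ->
  upper_central (c - n) x.
Proof.
move=> nc G1; move: {2}(c - n)%N (erefl (c - n)%N) => m.
elim: m n x nc => [|m IH] n x nc e lx; rewrite e.
  have /eqP en : n == c by rewrite eqn_leq nc -subn_eq0 e.
  by move: lx; rewrite en G1.
move=> y; have ltnc : (n < c)%N by rewrite -subn_gt0 e.
have e' : (c - n.+1 = m)%N by rewrite subnS e.
rewrite -e'; apply: (IH n.+1) => //=.
by move=> A [_ sA]; apply: sA; exists x, y.
Qed.

Lemma nilpotent_upper_central :
  nilpotent_group G -> exists c, forall x, upper_central c x.
Proof.
move=> [c Gc]; exists c => x; rewrite -(subn0 c).
exact: lower_central_upper.
Qed.

End UpperCentralSeries.

(** * Bi-invariant orders and bounded sequences *)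

Section BiOrder.
Variables (G : groupType) (lt : G -> G -> Prop).
Hypothesis lt_order : bi_order lt.
Implicit Types f g h x : G.

Lemma bi_irr g : ~ lt g g. Proof. by case: lt_order. Qed.
Lemma bi_trans f g h : lt f g -> lt g h -> lt f h.
Proof. by case: lt_order => _ _ tr _; apply: tr. Qed.
Lemma bi_mul2l h f g : lt f g -> lt (h * f) (h * g).
Proof. by case: lt_order => _ _ _ bi fg; case: (bi f g h fg). Qed.
Lemma bi_mul2r h f g : lt f g -> lt (f * h) (g * h).
Proof. by case: lt_order => _ _ _ bi fg; case: (bi f g h fg). Qed.
Lemma bi_mul f g f' g' : lt f g -> lt f' g' -> lt (f * f') (g * g').
Proof. by move=> fg fg'; exact: bi_trans (bi_mul2l f fg') (bi_mul2r _ fg). Qed.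
Lemma bi_conj h f g : lt f g -> lt (f ^ h) (g ^ h).
Proof. by move=> fg; rewrite !conjgE; apply/bi_mul2l/bi_mul2r. Qed.
Lemma bi_inv f g : lt f g -> lt g^-1 f^-1.
Proof.
by move=> /(bi_mul2l g^-1)/(bi_mul2r f^-1); rewrite mulgK mulVg mul1g.
Qed.
Lemma pos_conj h g : lt 1 g -> lt 1 (g ^ h).
Proof. by move=> /(bi_conj h); rewrite conj1g. Qed.
Lemma pos_mul f g : lt 1 f -> lt 1 g -> lt 1 (f * g).
Proof. by move=> f0 g0; rewrite -(mulg1 1); apply: bi_mul. Qed.
Lemma pos_exp g n : lt 1 g -> lt 1 (g ^+ n.+1).
Proof.
move=> g0; elim: n => [|n IH]; first by rewrite expg1.
by rewrite expgS; apply: pos_mul.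
Qed.
Lemma pos_div f g : lt 1 (f^-1 * g) <-> lt f g.
Proof.
split=> [/(bi_mul2l f)|/(bi_mul2l f^-1)]; first by rewrite mulg1 mulVKg.
by rewrite mulVg.
Qed.

Definition bounded_seq (f : int -> G) :=
  exists a b, forall i, lt a (f i) /\ lt (f i) b.

(** [f i, w] is the product of (f i)^-1 and the conjugate of f i by w. *)
Lemma bounded_comm (f : int -> G) w :
  bounded_seq f -> bounded_seq (fun i => [~ f i, w]).
Proof.
move=> [a [b fab]]; exists (b^-1 * a ^ w), (a^-1 * b ^ w) => i.
have [fa fb] := fab i.
by rewrite commgEl; split; apply: bi_mul; do ?[exact: bi_inv|exact: bi_conj].
Qed.

End BiOrder.

Section BoundedPowers.
Variables (G : groupType) (lt : G -> G -> Prop) (c : nat).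
Hypothesis lt_order : bi_order lt.
Hypothesis lt_arch : archimedean_order lt.
Hypothesis nilG : forall x : G, upper_central c x.
Hypothesis center_total : forall z : G, central z -> z <> 1 ->
  lt 1 z \/ lt 1 z^-1.

(** Commutators with w send a bounded sequence that is i |-> u^i modulo Z_n to a
    bounded sequence that is i |-> [u, w]^i modulo Z_(n-1); for n = 0 the
    sequence consists of the powers of the central element u itself.  Sequences
    that are powers only modulo Z_n make the induction go through, because
    [u^i, w] need not be a power of [u, w]. *)
Lemma bounded_hom_upper_central n u (f : int -> G) :
  upper_central n.+1 u -> bounded_seq lt f ->
  (forall i, cosetg (upper_central_nsg G n) (f i)
             = expgz (cosetg (upper_central_nsg G n) u) i) ->
  upper_central n u.
Proof.
elim: n u f => [|n IH] u f uu bf fE.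
  have fE' i : f i = expgz u i.
    have := fE i; rewrite -gmulfXz => /cosetgP /= /eqP.
    by rewrite mulg_eq1 => /eqP/invg_inj.
  have cu : central u by move=> y; apply/commgP/eqP/uu.
  case: bf => a [b bf] /=; apply: contrapT => u1.
  case: (center_total cu u1) => u0; apply: lt_arch.
    by exists u, b; split=> // i; rewrite -fE'; case: (bf i).
  exists u^-1, b; split=> // i.
  have -> : expgz u^-1 i = expgz u (- i)%R.
    by rewrite expgzN; case: i => k /=; rewrite expVgn.
  by rewrite -fE'; case: (bf (- i)%R).
move=> w; apply: (IH _ (fun i => [~ f i, w])); first exact: uu.
  exact: bounded_comm.
move=> i; set N := upper_central_nsg G n.
(* Modulo Z_n, f i is u^i times a central element, which commutators ignore. *)
have cuw : central [~ cosetg N u, cosetg N w].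
  by rewrite -gmulfR; apply/central_coset/uu.
have /esym := fE i; rewrite -gmulfXz => /cosetgP/central_coset => ce.
rewrite -[f i](mulVKg (expgz u i)) gmulfR gmulfM (commMr_central _ _ ce).
by rewrite gmulfXz commXz_central // gmulfR.
Qed.

Lemma bounded_powers_eq1 u : bounded_seq lt (expgz u) -> u = 1.
Proof.
move=> bu; have : upper_central c u by exact: nilG.
elim: (c) => [//|n IH] un; apply/IH/(bounded_hom_upper_central un bu) => i.
exact: gmulfXz.
Qed.

End BoundedPowers.

(** * The module generated by commuting conjugates *)

Section ConjugationModule.
Variables (G : groupType) (y g : G) (M : set G).
Hypothesis M_subgroup : is_subgroup M.
Hypothesis M_abelian : forall a b, M a -> M b -> commute a b.
Hypothesis M_conj : forall a, M a -> M (a ^ y).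
Hypothesis M_g : M g.
Implicit Types p q : {poly int}.

(** The action of p on g when M is seen as a Z[X]-module, X being conjugation by
    y, written in Horner form. *)
Definition conj_eval (p : {poly int}) : G :=
  foldr (fun a v => v ^ y * expgz g a) 1 p.

Local Arguments conj_eval p%_R.

Lemma mem_expgz i : M (expgz g i).
Proof.
have [M1 MM MV] := M_subgroup.
have MX n : M (g ^+ n).
  by elim: n => [|n IH]; rewrite ?expg0 // expgS; apply: MM.
by case: i => n /=; [apply: MX | apply/MV/MX].
Qed.

Lemma mem_conj_eval p : M (conj_eval p).
Proof.
have [M1 MM MV] := M_subgroup; rewrite /conj_eval.
elim: (polyseq p) => [|a s IH] //=; apply: MM; last exact: mem_expgz.
exact: M_conj.
Qed.

Lemma conj_eval0 : conj_eval 0 = 1.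
Proof. by rewrite /conj_eval polyseq0. Qed.

Lemma conj_eval_cons p a :
  conj_eval (p * 'X + a%:P) = conj_eval p ^ y * expgz g a.
Proof.
rewrite -cons_poly_def /conj_eval polyseq_cons.
case: ifP => // /negbFE; rewrite /nilp size_poly_eq0 => /eqP ->.
rewrite polyseq0 /= conj1g polyseqC; case: eqP => [->|] /=.
  by rewrite expg0 mulg1.
by rewrite conj1g.
Qed.

Lemma conj_evalMX p : conj_eval (p * 'X) = conj_eval p ^ y.
Proof. by rewrite -[(p * 'X)%R]addr0 -polyC0 conj_eval_cons /= expg0 mulg1. Qed.

Lemma conj_evalC a : conj_eval a%:P = expgz g a.
Proof.
rewrite -[(a%:P)%R]add0r -(mul0r 'X%R) conj_eval_cons conj_eval0.
by rewrite conj1g mul1g.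
Qed.

Lemma conj_evalD p q : conj_eval (p + q) = conj_eval p * conj_eval q.
Proof.
elim/poly_ind: p q => [|p a IH] q; first by rewrite add0r conj_eval0 mul1g.
elim/poly_ind: q => [|q b _]; first by rewrite addr0 conj_eval0 mulg1.
rewrite addrACA -mulrDl -polyCD !conj_eval_cons IH conjMg expgzD.
have := M_abelian (M_conj (mem_conj_eval q)) (mem_expgz a).
move: (conj_eval p ^ y) (conj_eval q ^ y) => u v vga.
by rewrite -!mulgA [v * (_ * _)]mulgA vga !mulgA.
Qed.

Lemma conj_evalN p : conj_eval (- p) = (conj_eval p)^-1.
Proof. by apply/esym/mulg1_eq; rewrite -conj_evalD subrr conj_eval0. Qed.

Lemma conj_evalMn p n : conj_eval (n%:R * p) = conj_eval p ^+ n.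
Proof.
elim: n => [|n IH]; first by rewrite mul0r conj_eval0.
by rewrite expgS -IH -conj_evalD mulrSr mulrDl mul1r addrC.
Qed.

Lemma conj_eval_comm p : conj_eval (('X - 1) * p) = [~ conj_eval p, y].
Proof.
rewrite mulrBl mul1r addrC conj_evalD conj_evalN [('X * p)%R]mulrC conj_evalMX.
by rewrite commgEl.
Qed.

(** X - 1 acts as the commutator with y, which descends the upper central
    series. *)
Lemma conj_eval_unipotent n p :
  upper_central n (conj_eval p) -> conj_eval (('X - 1) ^+ n * p) = 1.
Proof.
elim: n p => [|n IH] p /=; first by rewrite expr0 mul1r.
by move=> up; rewrite exprSr -mulrA; apply: IH; rewrite conj_eval_comm.
Qed.

(** (y a)^n = y^n a^(y^(n-1)) ... a^y a. *)
Lemma conj_eval_geom n p :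
  (y * conj_eval p) ^+ n = y ^+ n * conj_eval (geom n 'X * p)%R.
Proof.
elim: n => [|n IH]; first by rewrite /geom big_ord0 mul0r conj_eval0 mulg1.
rewrite expgSr IH geom_recl mulrDl mul1r conj_evalD mulrAC conj_evalMX conjgE.
by rewrite expgSr !mulgA mulgK.
Qed.

Variable lt : G -> G -> Prop.
Hypothesis lt_order : bi_order lt.
Hypothesis g_pos : lt 1 g.

Lemma conj_eval_nneg_pos p :
  p \is a nneg_poly -> (0 < p.[1])%R -> lt 1 (conj_eval p).
Proof.
move=> np p1.
suff [[e _]|//] : ((p.[1] = 0)%R /\ conj_eval p = 1) \/ lt 1 (conj_eval p).
  by move: p1; rewrite e ltxx.
elim/poly_ind: p np {p1} => [|p a IH] np.
  by left; rewrite horner0 conj_eval0.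
have /polyOverP nc := np.
have {}IH : ((p.[1] = 0)%R /\ conj_eval p = 1) \/ lt 1 (conj_eval p).
  apply: IH; apply/polyOverP => i.
  by have := nc i.+1; rewrite coefD coefMX coefC addr0.
have : (0 <= a)%R by have := nc 0%N; rewrite coefD coefMX coefC add0r.
rewrite conj_eval_cons !hornerE; case: a {np nc} => [[|n]|n] //= _.
  rewrite expg0 mulg1; case: IH => [[-> ->]|IH]; last by right; apply: pos_conj.
  by left; rewrite conj1g addr0.
right; case: IH => [[_ ->]|IH]; first by rewrite conj1g mul1g; apply: pos_exp.
by apply: pos_mul => //; [apply: pos_conj | apply: pos_exp].
Qed.

Hypothesis lt_prim : primitive_order lt.

(** Primitivity applied to y^n < (y a)^n, for a = conj_eval p. *)
Lemma conj_eval_geom_pos n p :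
  lt 1 (conj_eval (geom n 'X * p)%R) -> lt 1 (conj_eval p).
Proof.
move=> /(bi_mul2l lt_order (y ^+ n)); rewrite mulg1 -conj_eval_geom => /lt_prim.
by move=> /(bi_mul2l lt_order y^-1); rewrite mulVg mulKg.
Qed.

(** 1 + k (X - 1) sends g to g [g, y]^k.  Two multiplications by a geometric sum
    turn it into a polynomial with nonnegative coefficients, up to a multiple of
    a power of X - 1 which acts trivially. *)
Lemma pos_mul_comm_exp c (k : nat) : (forall x : G, upper_central c x) ->
  lt 1 (g * [~ g, y] ^+ k).
Proof.
move=> nilG; have [n [q [s [nq q1 E]]]] := smoothing_certificate k c.
have e1 : conj_eval 1 = g by rewrite -[1%R]/(1%:P)%R conj_evalC.
suff : lt 1 (conj_eval (1 + k%:R * ('X - 1))).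
  by rewrite conj_evalD conj_evalMn -[('X - 1)%R]mulr1 conj_eval_comm e1.
apply/(@conj_eval_geom_pos n)/(@conj_eval_geom_pos n); rewrite E conj_evalD.
rewrite exprSr -mulrA conj_eval_unipotent ?mulg1 //.
exact: conj_eval_nneg_pos.
Qed.

End ConjugationModule.

(** * Positive elements are central *)

Section AbelianClosure.
Variables (G : groupType) (y : G) (C : set G).
Hypothesis C_comm : forall a b, C a -> C b -> commute a b.
Hypothesis C_conj : forall a, C a -> C (a ^ y).

Definition centralizer (A : set G) : set G :=
  fun x => forall a, A a -> commute x a.

Lemma centralizer_subgroup A : is_subgroup (centralizer A).
Proof.
split=> [a _|x z cx cz a Aa|x cx a Aa]; first exact/commute_sym/commute1.
  by apply/commute_sym/commuteM; apply/commute_sym; [apply: cx | apply: cz].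
by apply/commute_sym/commuteV/commute_sym/cx.
Qed.

Lemma centralizer_conj A z : (forall a, A a -> A (a ^ z^-1)) ->
  forall x, centralizer A x -> centralizer A (x ^ z).
Proof.
move=> Az x cx a Aa; have := cx _ (Az a Aa).
by move=> /(congr1 (fun u => u ^ z)); rewrite (conjMg x) (conjMg _ x) conjgKV.
Qed.

(** An abelian subgroup containing C which inherits the stability of C under
    conjugation; it serves as the module of the polynomial action. *)
Definition bicentralizer := centralizer (centralizer C).

Lemma sub_bicentralizer a : C a -> bicentralizer a.
Proof. by move=> Ca x cx; apply/commute_sym/cx. Qed.

Lemma bicentralizer_abelian a b :
  bicentralizer a -> bicentralizer b -> commute a b.
Proof.
move=> Ma Mb; apply/commute_sym/Mb => x Cx; apply: Ma => z Cz; exact: C_comm.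
Qed.

Lemma bicentralizer_conj a : bicentralizer a -> bicentralizer (a ^ y).
Proof.
apply: centralizer_conj; apply: centralizer_conj => b Cb.
by rewrite invgK; apply: C_conj.
Qed.

End AbelianClosure.

Section PositiveCentral.
Variables (G : groupType) (lt : G -> G -> Prop) (c : nat).
Hypothesis lt_order : bi_order lt.
Hypothesis lt_prim : primitive_order lt.
Hypothesis lt_arch : archimedean_order lt.
Hypothesis nilG : forall x : G, upper_central c x.
Hypothesis center_total : forall z : G, central z -> z <> 1 ->
  lt 1 z \/ lt 1 z^-1.

(** Write Z_n for the n-th term of the upper central series and let y be in
    Z_(n+1).  The conjugates of g by elements of Z_(n+1) differ from g by
    elements of Z_n, with which positive elements commute by induction; hence
    they commute with each other, and g [g, y]^k and g [g, y^-1]^k are positive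
    for all k. *)
Lemma pos_commute_upper_central n g y :
  lt 1 g -> upper_central n y -> commute g y.
Proof.
elim: n g y => [|n IH] g y g0 uy /=; first by rewrite uy; apply: commute1.
have [U1 UM UV] := upper_central_subgroup G n.+1.
pose C : set G := fun x => exists2 h, upper_central n.+1 h & x = g ^ h.
have comm_pos x h : lt 1 x -> upper_central n.+1 h -> commute x [~ g, h].
  move=> x0 uh; apply: IH => //; rewrite -invgR.
  by have [_ _ VU] := upper_central_subgroup G n; apply/VU/uh.
have conjE h : g ^ h = g * [~ g, h] by rewrite commgEl mulVKg.
have C_comm a b : C a -> C b -> commute a b.
  move=> [h uh ->] [h' uh' ->]; rewrite (conjE h'); apply: commuteM.
    rewrite conjE; apply/commute_sym/commuteM; first exact: commute_refl.
    exact: comm_pos.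
  by apply: comm_pos => //; apply: pos_conj.
have C_conj z a : upper_central n.+1 z -> C a -> C (a ^ z).
  by move=> uz [h uh ->]; exists (h * z); [apply: UM | rewrite conjgM].
have C_g : C g by exists 1; rewrite ?conjg1.
have pos z k : upper_central n.+1 z -> lt 1 (g * [~ g, z] ^+ k).
  move=> uz; apply: (@pos_mul_comm_exp _ z g (bicentralizer C)) nilG => //.
  - exact: centralizer_subgroup.
  - by move=> a b; apply: bicentralizer_abelian.
  - by move=> a; apply: bicentralizer_conj => b; apply: C_conj.
  - exact: sub_bicentralizer.
set u := [~ g, y].
have cgu : commute g u by apply: comm_pos.
(* The inequality for y^-1, conjugated by y, bounds the negative powers of u. *)
have posV k : lt 1 (g * u * u ^- k).
  have := pos_conj lt_order y (pos y^-1 k (UV _ uy)).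
  rewrite conjMg conjE -/u conjXg.
  have -> : [~ g, y^-1] ^ y = u^-1.
    by rewrite /u /commg /conjg !gnorm.
  by rewrite expVgn.
have low i : lt (g * g * u)^-1 (expgz u i).
  apply/(pos_div lt_order); rewrite invgK; case: i => k /=.
    rewrite -mulgA -mulgA -expgS; apply: pos_mul => //; exact: pos.
  by rewrite -[g * g * u]mulgA -mulgA; apply: pos_mul => //; exact: posV.
apply/commgP/eqP.
apply: (bounded_powers_eq1 lt_order lt_arch nilG center_total).
exists (g * g * u)^-1, (g * g * u) => i; split=> //.
by have := bi_inv lt_order (low (- i)%R); rewrite expgzN !invgK.
Qed.

Lemma pos_central g : lt 1 g -> central g.
Proof. by move=> g0 y; apply: (@pos_commute_upper_central c). Qed.

End PositiveCentral.

(** * Hoelder's theorem *)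

Section Hoelder.
Variables (R : realType) (A : groupType) (lt : A -> A -> Prop).
Hypothesis lt_order : bi_order lt.
Hypothesis lt_arch : archimedean_order lt.
Hypothesis A_comm : forall x y : A, commute x y.
Hypothesis lt_total : forall x : A, x <> 1 -> lt 1 x \/ lt 1 x^-1.
Implicit Types (x y z : A).

Definition eq_or_lt x y := x = y \/ lt x y.

Lemma eq_or_lt_total x y : eq_or_lt x y \/ lt y x.
Proof.
case: (pselect (y^-1 * x = 1)) => [/eqP|/lt_total[]].
- by rewrite mulg_eq1 => /eqP/invg_inj ->; left; left.
- by move/(pos_div lt_order); right.
by rewrite invgM invgK => /(pos_div lt_order); left; right.
Qed.

Lemma eq_or_lt_trans x y z : eq_or_lt x y -> lt y z -> lt x z.
Proof. by case=> [->//|xy yz]; apply: bi_trans xy yz. Qed.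

Lemma eq_or_lt_mul x y x' y' :
  eq_or_lt x y -> eq_or_lt x' y' -> eq_or_lt (x * x') (y * y').
Proof.
case=> [->|xy] [->|xy']; [by left|right|right|right].
- exact: bi_mul2l.
- exact: bi_mul2r.
- exact: bi_mul.
Qed.

Lemma eq_or_lt_exp x y n : eq_or_lt x y -> eq_or_lt (x ^+ n) (y ^+ n).
Proof.
move=> xy; elim: n => [|n IH]; first by left.
by rewrite !expgS; apply: eq_or_lt_mul.
Qed.

Lemma lt_exp x y n : lt x y -> lt (x ^+ n.+1) (y ^+ n.+1).
Proof.
move=> xy; elim: n => [|n IH]; first by rewrite !expg1.
by rewrite expgS [y ^+ _]expgS; apply: bi_mul.
Qed.

Lemma lt_expgz z i j : lt 1 z -> (i < j)%R -> lt (expgz z i) (expgz z j).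
Proof.
move=> z0 ij; have -> : j = (i + (`|j - i|.-1.+1)%:Z)%R by lia.
rewrite expgzD -{1}[expgz z i]mulg1; apply: bi_mul2l => //.
exact: (pos_exp lt_order `|j - i|.-1 z0).
Qed.

Lemma archimedean_nat z x : lt 1 z -> exists n : nat, lt x (z ^+ n).
Proof.
move=> z0; have [i nzx] : exists i, ~ lt (expgz z i) x.
  apply: contrapT => /forallNP ni; apply: lt_arch; exists z, x; split=> // i.
  by apply: contrapT; apply: ni.
case: (eq_or_lt_total x (expgz z i)) => // xz; exists `|i|.+1.
apply: (eq_or_lt_trans xz).
by apply: (@lt_expgz _ _ (Posz `|i|.+1)) => //; lia.
Qed.

Section Unit.
Variable z : A.
Hypothesis z0 : lt 1 z.

(** The lower Dedekind cut of log x / log z. *)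
Definition cut x : set R := fun r => exists (m : int) (n : nat),
  (r = m%:~R / n.+1%:R)%R /\ eq_or_lt (expgz z m) (x ^+ n.+1).

Lemma cutP x : has_sup (cut x).
Proof.
split.
  have [n xz] := archimedean_nat x^-1 z0.
  exists (- n%:R)%R, (- n%:Z)%R, 0%N; split; first by rewrite divr1 mulrNz.
  right; rewrite expg1 expgzN /= -[x]invgK; exact: bi_inv.
have [N xz] := archimedean_nat x z0; exists (N%:R)%R => _ [m [n [-> mx]]].
rewrite ler_pdivrMr ?ltr0n // -natrM.
rewrite -[((N * n.+1)%:R)%R]/((N * n.+1)%:Z%:~R)%R ler_int.
rewrite leNgt; apply/negP => Nm; apply: (bi_irr lt_order (g := expgz z m)).
apply: (eq_or_lt_trans mx).
have := bi_trans lt_order (lt_exp n xz) (_ : lt _ (expgz z m)); apply.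
by rewrite -expgnA; apply: (@lt_expgz _ (Posz (N * n.+1))).
Qed.

Definition slope x : R := sup (cut x).

Lemma slope_ge x m n : eq_or_lt (expgz z m) (x ^+ n.+1) ->
  (m%:~R / n.+1%:R <= slope x)%R.
Proof. by move=> mx; apply: (ub_le_sup (proj2 (cutP x))); exists m, n. Qed.

Lemma slope_le x r : (forall m n, eq_or_lt (expgz z m) (x ^+ n.+1) ->
  (m%:~R / n.+1%:R <= r)%R) -> (slope x <= r)%R.
Proof.
move=> ler; apply: ge_sup; first by case: (cutP x).
by move=> _ [m [n [-> mx]]]; apply: ler.
Qed.

Lemma slope_superadd x y : (slope x + slope y <= slope (x * y))%R.
Proof.
rewrite -lerBrDr; apply: slope_le => m n mx.
rewrite lerBrDr addrC -lerBrDr; apply: slope_le => m' n' my.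
rewrite lerBrDr.
have -> : (m'%:~R / n'.+1%:R + m%:~R / n.+1%:R =
  (m * n'.+1%:Z + m' * n.+1%:Z)%:~R / (n.+1 * n'.+1).-1.+1%:R :> R)%R.
  rewrite prednK ?muln_gt0 // natrM rmorphD !rmorphM /=.
  by field; rewrite !nat1r !pnatr_eq0.
apply: slope_ge; rewrite prednK ?muln_gt0 //.
rewrite expgzD !expgzM expgMn //; apply: eq_or_lt_mul.
  by rewrite expgnA; apply: eq_or_lt_exp.
by rewrite mulnC expgnA; apply: eq_or_lt_exp.
Qed.

Lemma slope1 : (slope 1 <= 0)%R.
Proof.
apply: slope_le => m n; rewrite expg1n => mz.
rewrite pmulr_lle0 ?invr_gt0 ?ltr0n // lerz0 leNgt; apply/negP => m0.
exact: bi_irr lt_order _ (eq_or_lt_trans mz (lt_expgz z0 m0)).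
Qed.

Lemma int_part w :
  exists m, eq_or_lt (expgz z m) w /\ lt w (expgz z (m + 1)%R).
Proof.
have [N wz] := archimedean_nat w^-1 z0; have [N' wz'] := archimedean_nat w z0.
have ex : exists k, `[< lt w (expgz z (k%:Z - N%:Z)%R) >].
  by exists (N + N')%N; apply/asboolP; rewrite PoszD addrC addrA addNr add0r.
have [k /asboolP wk kmin] := ex_minnP ex.
case: k wk kmin => [|k] wk kmin.
  case: (bi_irr lt_order (g := w)); apply: (bi_trans lt_order wk).
  by rewrite sub0r expgzN -[w]invgK; apply: bi_inv.
exists (k%:Z - N%:Z)%R; split; last first.
  by have -> : (k%:Z - N%:Z + 1 = k.+1%:Z - N%:Z)%R by lia.
case: (eq_or_lt_total (expgz z (k%:Z - N%:Z)%R) w) => // /asboolP /kmin.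
by rewrite ltnn.
Qed.

(** If z^m <= x^n < z^(m+1), then m/n and - (m+1)/n are lower bounds of the
    slopes of x and x^-1, whose sum is therefore at least - 1/n, for every
    n > 0. *)
Lemma slopeV x : (slope x^-1 = - slope x)%R.
Proof.
have le0 : (slope x + slope x^-1 <= 0)%R.
  by apply: le_trans (slope_superadd _ _) _; rewrite mulgV slope1.
suff : (0 <= slope x + slope x^-1)%R by move: le0; lra.
have gen n : (- n.+1%:R^-1 <= slope x + slope x^-1)%R.
  have [m [mx xm]] := int_part (x ^+ n.+1).
  have h1 := slope_ge mx.
  have h2 : ((- (m + 1))%:~R / n.+1%:R <= slope x^-1)%R.
    by apply: slope_ge; right; rewrite expgzN expVgn; apply: bi_inv.
  apply: le_trans (lerD h1 h2); rewrite -mulrDl rmorphN rmorphD /= opprD addrA.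
  by rewrite subrr add0r mulN1r.
rewrite leNgt; apply/negP => neg.
move: neg; rewrite -oppr_gt0 => /ltr_add_invr[n]; rewrite add0r ltrNr ltNge.
by rewrite gen.
Qed.

(** A superadditive odd function is additive. *)
Lemma slopeD x y : (slope (x * y) = slope x + slope y)%R.
Proof.
apply/eqP; rewrite eq_le slope_superadd andbT.
by have := slope_superadd (x * y) y^-1; rewrite mulgK slopeV; lra.
Qed.

Lemma slope_pos x : lt 1 x -> (0 < slope x)%R.
Proof.
move=> x0; have [[|n] zx] := archimedean_nat z x0.
  by case: (bi_irr lt_order (bi_trans lt_order zx z0)).
have := @slope_ge x 1 n (or_intror zx); apply: lt_le_trans.
by rewrite mul1r invr_gt0 ltr0n.
Qed.

End Unit.

(** The slope with respect to any positive z works; it vanishes only at 1 since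
    it is positive on positive elements.  Without positive elements the group is
    trivial. *)
Lemma hoelder : exists h : A -> R,
  [/\ injective h, {morph h : x y / x * y >-> (x + y)%R}
    & forall x, (0 < h x)%R <-> lt 1 x].
Proof.
case: (pselect (exists z, lt 1 z)) => [[z z0]|nz].
  have hV := slopeV z0; have hD := slopeD z0; have hP := slope_pos z0.
  have h1 : slope z 1 = 0%R by have := hD 1 1; rewrite mulg1; lra.
  have h0 x : x <> 1 -> slope z x <> 0%R.
    by case/lt_total => /hP; rewrite ?hV; lra.
  exists (slope z); split=> // [x y e|x].
    apply/divg1_eq; apply: contrapT => /h0; apply.
    by rewrite hD hV e subrr.
  split=> [hx|/hP//]; have [//|/hP] : lt 1 x \/ lt 1 x^-1.
    by apply: lt_total => x1; move: hx; rewrite x1 h1 ltxx.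
  by rewrite hV; lra.
exists (fun=> 0%R); split=> [x y _|x y|x]; last 2 first.
- by rewrite addr0.
- by rewrite ltxx; split=> // x0; case: nz; exists x.
have all1 (w : A) : w = 1.
  apply: contrapT => w1; apply: nz.
  by case: (lt_total w1) => w0; eexists; exact: w0.
by rewrite (all1 x) (all1 y).
Qed.

End Hoelder.

(** * The quotient by the largest normal antichain *)

Section Kernel.
Variables (Q : groupType) (lt : Q -> Q -> Prop).
Hypothesis lt_order : bi_order lt.

Definition order_kernel : set Q := fun x => forall g, lt 1 g <-> lt 1 (x * g).

Lemma order_kernel_subgroup : is_subgroup order_kernel.
Proof.
split=> [g|x y kx ky g|x kx g]; first by rewrite mul1g.
  by rewrite -mulgA -(kx (y * g)).
by rewrite (kx (x^-1 * g)) mulVKg.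
Qed.

Lemma order_kernel_conj x h : order_kernel x -> order_kernel (x ^ h).
Proof.
have posJ g u : lt 1 (g ^ u) <-> lt 1 g.
  by split=> [/(pos_conj lt_order u^-1)|]; [rewrite conjgK | apply: pos_conj].
move=> kx g; rewrite -[g](conjgKV h) -conjMg (posJ (g ^ h^-1)) (posJ (x * _)).
exact: kx.
Qed.

Definition order_kernel_nsg : normalSubgroup Q :=
  NormalSubgroup order_kernel_subgroup order_kernel_conj.

Lemma order_kernel_antichain : antichain lt order_kernel_nsg.
Proof.
move=> s t ks kt /(pos_div lt_order).
have [_ kM kV] := order_kernel_subgroup.
have k := kM _ _ (kV _ ks) kt.
rewrite -[s^-1 * t]mulg1 -(k 1); exact: bi_irr.
Qed.

(** An order induced from Q/H does not see multiplication by elements of H. *)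
Lemma antichain_sub_kernel (H : normalSubgroup Q) : factorizing_order lt ->
  antichain lt H -> forall x, nsg_set H x -> order_kernel x.
Proof.
move=> fact /fact [ltH _ ltE] x Hx g; have e : cosetg H g = cosetg H (x * g).
  by apply/cosetgP; have := nsg_conj g Hx; rewrite conjgE.
have E a b : lt a b <-> ltH (cosetg H a) (cosetg H b) by exact: ltE.
by rewrite (E 1 g) (E 1 (x * g)) e.
Qed.

End Kernel.

Section Cyclic.
Variables (G : groupType) (lt : G -> G -> Prop).
Hypothesis lt_order : bi_order lt.
Hypothesis lt_prim : primitive_order lt.

Lemma pos_of_pos_exp x n : lt 1 (x ^+ n) -> lt 1 x.
Proof. by rewrite -{1}(expg1n G n) => /lt_prim. Qed.

Lemma central_cyclic_subgroup z : central z ->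
  exists N : normalSubgroup G,
    forall x, nsg_set N x <-> exists i, x = expgz z i.
Proof.
move=> cz; pose S : set G := fun x => exists i, x = expgz z i.
have S_sub : is_subgroup S.
  split; first by exists 0%R.
    by move=> _ _ [i ->] [j ->]; exists (i + j)%R; rewrite expgzD.
  by move=> _ [i ->]; exists (- i)%R; rewrite expgzN.
have S_conj x g : S x -> S (x ^ g).
  move=> [i ->]; exists i; apply/conjg_fixP/commgP.
  exact/commute_sym/commuteXz/commute_sym/cz.
by exists (NormalSubgroup S_sub S_conj).
Qed.

(** The cyclic subgroup of a central z <> 1 is normal and nontrivial, hence not
    an antichain: some power of z is positive, and primitivity takes the
    root. *)
Lemma central_total :
  (forall N : normalSubgroup G, antichain lt N ->
     forall x, nsg_set N x -> x = 1) ->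
  forall z, central z -> z <> 1 -> lt 1 z \/ lt 1 z^-1.
Proof.
move=> triv z cz z1; have [N NE] := central_cyclic_subgroup cz.
apply: contrapT => /not_orP[nz nzV]; apply: z1; apply: (triv N); last first.
  by apply/NE; exists 1%R.
move=> _ _ /NE[i ->] /NE[j ->] /(pos_div lt_order).
rewrite -expgzN -expgzD; case: (- i + j)%R => n; first by move/pos_of_pos_exp.
by rewrite /= -expVgn => /pos_of_pos_exp.
Qed.

End Cyclic.

Section QuotientOrder.
Variables (Q : groupType) (lt : Q -> Q -> Prop) (P : normalSubgroup Q).
Variable ltP : quotientg P -> quotientg P -> Prop.
Hypothesis ltP_coset : forall g h, lt g h <-> ltP (cosetg P g) (cosetg P h).

Lemma quotient_primitive : primitive_order lt -> primitive_order ltP.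
Proof.
move=> prim a b n; rewrite -(cosetg_repr a) -(cosetg_repr b) -!gmulfXn.
by rewrite -!ltP_coset; apply: prim.
Qed.

Lemma quotient_archimedean : archimedean_order lt -> archimedean_order ltP.
Proof.
move=> arch [a [b [a0 ab]]]; apply: arch; exists (repr a), (repr b).
split; first by rewrite ltP_coset cosetg_repr gmulf1.
move=> i; have := ab i; rewrite -{1}(cosetg_repr a) -{1}(cosetg_repr b).
by rewrite -gmulfXz -ltP_coset.
Qed.

Lemma quotient_upper_central n x :
  upper_central n x -> upper_central n (cosetg P x).
Proof.
elim: n x => [|n IH] x /= => [->|ux b]; first exact: gmulf1.
by rewrite -(cosetg_repr b) -gmulfR; apply/IH/ux.
Qed.

(** The preimage in Q of a normal antichain of Q/P is again one. *)
Lemma quotient_antichain_trivial :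
  (forall H : normalSubgroup Q, antichain lt H ->
     forall x, nsg_set H x -> nsg_set P x) ->
  forall K : normalSubgroup (quotientg P), antichain ltP K ->
    forall a, nsg_set K a -> a = 1.
Proof.
move=> maxP K antiK a Ka; have [K1 KM KV] := nsg_subgroup K.
pose S : set Q := fun x => nsg_set K (cosetg P x).
have S_sub : is_subgroup S.
  split=> [|x y|x]; rewrite /S; first by rewrite gmulf1.
    by rewrite gmulfM; apply: KM.
  by rewrite gmulfV; apply: KV.
have S_conj x g : S x -> S (x ^ g).
  by rewrite /S gmulfJ; apply: nsg_conj.
have Pa : nsg_set P (repr a).
  apply: (maxP (NormalSubgroup S_sub S_conj)); last first.
    by rewrite /= /S cosetg_repr.
  by move=> s t Ss St; rewrite ltP_coset; apply: antiK.
rewrite -(cosetg_repr a); transitivity (cosetg P 1); last exact: gmulf1.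
by apply/esym/cosetgP; rewrite invg1 mul1g.
Qed.

End QuotientOrder.

(** * The structure of full archimedean orders *)

Theorem theorem2 (R : realType) (Q : groupType) (lt : Q -> Q -> Prop)
    (Qfg : finitely_generated Q) (Qnil : nilpotent_group Q)
    (lt_order : bi_order lt) (lt_full : full_order lt)
    (lt_arch : archimedean_order lt) :
  exists (P : normalSubgroup Q) (iota : centerg (quotientg P) -> R),
    [/\ injective iota,
        {morph iota : x y / (x * y)%g >-> (x + y)%R}
      & forall g : Q, lt 1%g g <->
          exists c : central (cosetg P g), (0 < iota (to_center c))%R].
Proof.
have [lt_prim lt_fact] := lt_full.
pose P := order_kernel_nsg lt_order; exists P.
have [ltP ltP_order ltPE] := lt_fact P (@order_kernel_antichain _ _ lt_order).
have ltP_prim := quotient_primitive ltPE lt_prim.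
have ltP_arch := quotient_archimedean ltPE lt_arch.
have [c Qc] := nilpotent_upper_central Qnil.
have Pc (a : quotientg P) : upper_central c a.
  by rewrite -(cosetg_repr a); apply: quotient_upper_central.
have P_max (H : normalSubgroup Q) :
    antichain lt H -> forall x, nsg_set H x -> nsg_set P x.
  exact: antichain_sub_kernel.
have ltP_total :=
  central_total ltP_order ltP_prim (quotient_antichain_trivial ltPE P_max).
have ltP_central := pos_central ltP_order ltP_prim ltP_arch Pc ltP_total.
pose ltZ (x y : centerg (quotientg P)) := ltP (val x) (val y).
have ltZ_order : bi_order ltZ.
  have [irr asym tr bi] := ltP_order; split=> [x|x y|x y z|x y z]; rewrite /ltZ.
  - exact: irr.
  - exact: asym.
  - exact: tr.
  - by rewrite !valM; apply: bi.
have val_expgz (x : centerg (quotientg P)) i :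
    val (expgz x i) = expgz (val x) i.
  exact: gmulfXz.
have ltZ_arch : archimedean_order ltZ.
  move=> [x [y [x0 xy]]]; apply: ltP_arch; exists (val x), (val y); split=> //.
  by move=> i; rewrite -val_expgz; apply: xy.
have centerP (x : centerg (quotientg P)) : central (val x).
  exact: asboolW (valP x).
have Z_comm (x y : centerg (quotientg P)) : commute x y.
  by apply: val_inj; rewrite !valM; apply: centerP.
have ltZ_total x : x <> 1 -> ltZ 1 x \/ ltZ 1 x^-1.
  move=> x1; apply: ltP_total; first exact: centerP.
  by move=> e; apply: x1; apply: val_inj.
have [iota [iota_inj iotaD iota_pos]] :=
  hoelder R ltZ_order ltZ_arch Z_comm ltZ_total.
exists iota; split=> // g; rewrite ltPE; split=> [g0|[cg]].
  by exists (ltP_central _ g0); apply/iota_pos.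
by move/iota_pos.
Qed.
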